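(* Let $X$ be a locally compact space, $\kappa$ a strictly positive definite kernel on $X$, $\mathbf A=(A_i)_{i\in I}$ a generalized condenser in $X$ with $c_\kappa(A_i)>0$ for all $i\in I$, $\mathbf a=(a_i)_{i\in I}$ with $a_i\in(0,\infty)$, $\mathbf f=(f_i)_{i\in I}$ an external field, and $\boldsymbol\xi=(\xi^i)_{i\in I}$ a constraint (all as described in the context). If the class $\mathfrak S^{\boldsymbol\xi}_{\kappa,\mathbf f}(\mathbf A,\mathbf a;X)$ is nonempty, then it reduces to a single element whenever all the $A_i$, $i\in I$, are mutually essentially disjoint, i.e. $c_\kappa(A_i\cap A_j)=0$ for all $i\ne j$.
   Context: $X$ is a locally compact Hausdorff space, metrizable and countable at infinity. A kernel $\kappa$ on $X$ is a symmetric lower semicontinuous function $X\times X\to[0,\infty]$. For signed Radon measures $\mu,\nu$ on $X$, $\kappa(\mu,\nu)=\iint\kappa(x,y)\,d\mu(x)\,d\nu(y)$ (when well defined). $\kappa$ is strictly positive definite if $\kappa(\mu,\mu)\geqslant0$ for every signed Radon measure $\mu$ for which it is well defined, and $\kappa(\mu,\mu)>0$ unless $\mu=0$. $\mathfrak M^+(Q;X)$ is the set of positive Radon measures $\mu$ on $X$ carried by $Q$ (i.e. $X\setminus Q$ is $\mu$-negligible), and $\mathcal E^+_\kappa(Q;X)$ the set of those with $\kappa(\mu,\mu)<\infty$. $c_\kappa(Q)=[\inf\{\kappa(\mu,\mu):\mu\in\mathcal E^+_\kappa(Q;X),\mu(Q)=1\}]^{-1}$ ($\inf\varnothing=+\infty$,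 $1/(+\infty)=0$, $1/0=+\infty$). A generalized condenser is an ordered finite collection $\mathbf A=(A_i)_{i\in I}$ ($I\neq\varnothing$) of nonempty locally closed subsets of $X$ (intersections of an open and a closed set), with signs $s_i=\pm1$, such that $A_i\cap A_j=\varnothing$ whenever $s_is_j=-1$. $\mathcal E^+_\kappa(\mathbf A;X)=\prod_{i\in I}\mathcal E^+_\kappa(A_i;X)$. For $\boldsymbol\mu=(\mu^i)_{i\in I}$ in it, $\kappa(\boldsymbol\mu,\boldsymbol\mu)=\sum_{i,j\in I}s_is_j\kappa(\mu^i,\mu^j)$. The external field: $f_i:X\to[-\infty,\infty]$ is $\mu$-measurable for every $\mu\in\mathcal E^+_\kappa(A_i;X)$; $G_{\kappa,\mathbf f}(\boldsymbol\mu)=\kappa(\boldsymbol\mu,\boldsymbol\mu)+2\sum_{i\in I}\int f_i\,d\mu^i$. The constraint: for each $i\in I$ either $\xi^i\in\mathfrak M^+(A_i;X)$ with $\xi^i(A_i)>a_i$, or $\xi^i=\infty$ (meaning no upper constraint on $\mu^i$). $\mathcal E^{\boldsymbol\xi}_{\kappa,\mathbf f}(\mathbf A,\mathbf a;X)$ is the set of $\boldsymbol\mu\in\mathcal E^+_\kappa(\mathbf A;X)$ with $\mu^i(A_i)=a_i$, $\mu^i\leqslant\xi^i$ for all $i\in I$ and $G_{\kappa,\mathbf f}(\boldsymbol\mu)$ finite; $\mathfrak S^{\boldsymbol\xi}_{\kappa,\mathbf f}(\mathbf A,\mathbf a;X)$ is the set of its elements minimizing $G_{\kappa,\mathbf f}$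 over it. *)

(* Defs.v *)
From HB Require Import structures.
From mathcomp Require Import all_boot all_order all_algebra.
From mathcomp Require Import all_classical all_reals all_analysis.
From mathcomp Require Import measurable_realfun.

Set Implicit Arguments.
Unset Strict Implicit.
Unset Printing Implicit Defensive.

Import Order.TTheory GRing.Theory Num.Theory.

Local Open Scope classical_set_scope.
Local Open Scope ring_scope.
Local Open Scope ereal_scope.

Definition borel (X : ptopologicalType) := g_sigma_algebraType (@open X).

(* Two library measures may differ on non-Borel sets, where their values carry
   no meaning; equality of measures is therefore taken on Borel sets only. *)
Definition eqm (R : realType) (X : ptopologicalType)
    (mu nu : {measure set (borel X) -> \bar R}) : Prop :=
  forall B : set (borel X), measurable B -> mu B = nu B.

Definition lem (R : realType) (X : ptopologicalType)
    (mu nu : {measure set (borel X) -> \bar R}) : Prop :=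
  forall B : set (borel X), measurable B -> mu B <= nu B.

Definition metrizable (R : realType) (X : ptopologicalType) : Prop :=
  exists d : X -> X -> R,
    [/\ forall x y, d x y = 0%R <-> x = y,
        forall x y, d x y = d y x,
        forall x y z, (d x z <= d x y + d y z)%R &
        forall (x : X) (U : set X), nbhs x U <->
          exists2 e : R, (0 < e)%R & [set y | (d x y < e)%R] `<=` U].

Definition countable_at_infinity (X : ptopologicalType) : Prop :=
  exists2 K : nat -> set X, (forall n, compact (K n)) & \bigcup_n K n = setT.

Definition locally_closed (X : ptopologicalType) (A : set X) : Prop :=
  exists U F : set X, [/\ open U, closed F & A = U `&` F].

Definition is_kernel (R : realType) (X : ptopologicalType)
    (k : X -> X -> \bar R) : Prop :=
  [/\ forall x y, 0 <= k x y,
      forall x y, k x y = k y x &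
      lower_semicontinuous (fun z : X * X => k z.1 z.2)].

(* On a locally compact, countable at infinity Hausdorff space, Bourbaki's
   positive Radon measures (positive functionals on the compactly supported
   continuous functions) correspond to the Borel measures below. Compact sets
   are Borel since X is assumed Hausdorff wherever this is used. *)
Definition radon (R : realType) (X : ptopologicalType)
    (mu : {measure set (borel X) -> \bar R}) : Prop :=
  (forall K : set X, compact K -> mu K < +oo) /\
  (forall B : set (borel X), measurable B ->
     mu B = ereal_sup [set mu K | K in [set K : set X | compact K /\ K `<=` B]]).

(* k is nonnegative and Borel on the product (it is lower semicontinuous and X
   is second countable), so the order of integration is irrelevant. *)
Definition energy (R : realType) (X : ptopologicalType) (k : X -> X -> \bar R)
    (mu nu : {measure set (borel X) -> \bar R}) : \bar R :=
  \int[mu]_x \int[nu]_y k x y.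

(* A signed Radon measure, given by its Jordan decomposition. Both parts may
   have infinite total mass, so it need not be a charge on the Borel sets. *)
Record signed_radon (R : realType) (X : ptopologicalType) := SignedRadon {
  sr_pos : {measure set (borel X) -> \bar R} ;
  sr_neg : {measure set (borel X) -> \bar R} ;
  sr_pos_radon : radon sr_pos ;
  sr_neg_radon : radon sr_neg ;
  sr_singular : exists P : set (borel X),
    [/\ measurable P, sr_pos (~` P) = 0 & sr_neg P = 0] }.

Definition sr_zero (R : realType) (X : ptopologicalType)
    (mu : signed_radon R X) : Prop :=
  sr_pos mu setT = 0 /\ sr_neg mu setT = 0.

Definition senergy_plus (R : realType) (X : ptopologicalType)
    (k : X -> X -> \bar R) (mu nu : signed_radon R X) : \bar R :=
  energy k (sr_pos mu) (sr_pos nu) + energy k (sr_neg mu) (sr_neg nu).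

Definition senergy_minus (R : realType) (X : ptopologicalType)
    (k : X -> X -> \bar R) (mu nu : signed_radon R X) : \bar R :=
  energy k (sr_pos mu) (sr_neg nu) + energy k (sr_neg mu) (sr_pos nu).

(* Well defined: no difference +oo - oo between the two halves. *)
Definition senergy_defined (R : realType) (X : ptopologicalType)
    (k : X -> X -> \bar R) (mu nu : signed_radon R X) : Prop :=
  senergy_plus k mu nu < +oo \/ senergy_minus k mu nu < +oo.

Definition senergy (R : realType) (X : ptopologicalType)
    (k : X -> X -> \bar R) (mu nu : signed_radon R X) : \bar R :=
  senergy_plus k mu nu - senergy_minus k mu nu.

Definition strictly_positive_definite (R : realType) (X : ptopologicalType)
    (k : X -> X -> \bar R) : Prop :=
  forall mu : signed_radon R X, senergy_defined k mu mu ->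
    0 <= senergy k mu mu /\ (~ sr_zero mu -> 0 < senergy k mu mu).

Definition carried_by (R : realType) (X : ptopologicalType) (Q : set X)
    (mu : {measure set (borel X) -> \bar R}) : Prop :=
  mu.-negligible (~` Q : set (borel X)).

Definition radon_on (R : realType) (X : ptopologicalType) (Q : set X) :
    set {measure set (borel X) -> \bar R} :=
  [set mu | radon mu /\ carried_by Q mu].

Definition finite_energy_on (R : realType) (X : ptopologicalType)
    (k : X -> X -> \bar R) (Q : set X) :
    set {measure set (borel X) -> \bar R} :=
  [set mu | radon_on Q mu /\ energy k mu mu < +oo].

(* Only meant for Borel Q, so that mu Q is meaningful. The inverse and the
   infimum of extended reals follow the conventions 0^-1 = +oo, +oo^-1 = 0 and
   inf set0 = +oo. *)
Definition capacity (R : realType) (X : ptopologicalType)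
    (k : X -> X -> \bar R) (Q : set X) : \bar R :=
  (ereal_inf [set energy k mu mu | mu in
    [set mu | finite_energy_on k Q mu /\ mu Q = 1]])^-1.

Record generalized_condenser (R : realType) (X : ptopologicalType) (I : finType)
    (A : I -> set X) (s : I -> R) : Prop := GeneralizedCondenser {
  gc_index : (0 < #|I|)%N ;
  gc_nonempty : forall i, A i !=set0 ;
  gc_locally_closed : forall i, locally_closed (A i) ;
  gc_sign : forall i, s i = 1%R \/ s i = (-1)%R ;
  gc_disjoint : forall i j, (s i * s j)%R = (-1)%R -> A i `&` A j = set0 }.

(* The library's [completed_algebra_gen mu] is the set of all B `|` N with B
   measurable and N mu-negligible, i.e. the completed sigma-algebra itself. For such f the library
   integral, a supremum over Borel simple functions, is the integral of f with
   respect to the completion of mu. *)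
Definition completed_measurable (R : realType) (X : ptopologicalType)
    (mu : {measure set (borel X) -> \bar R}) (f : X -> \bar R) : Prop :=
  forall Y : set (\bar R), measurable Y ->
    completed_algebra_gen mu (f @^-1` Y : set (borel X)).

Definition external_field (R : realType) (X : ptopologicalType)
    (k : X -> X -> \bar R) (I : finType) (A : I -> set X)
    (f : I -> X -> \bar R) : Prop :=
  forall i mu, finite_energy_on k (A i) mu -> completed_measurable mu (f i).

(* [None] stands for the constraint xi^i = infinity. *)
Definition constraint (R : realType) (X : ptopologicalType) (I : finType)
    (A : I -> set X) (a : I -> R)
    (xi : I -> option {measure set (borel X) -> \bar R}) : Prop :=
  forall i, if xi i is Some x then radon_on (A i) x /\ (a i)%:E < x (A i)
            else True.

Definition vector_energy (R : realType) (X : ptopologicalType)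
    (k : X -> X -> \bar R) (I : finType) (s : I -> R)
    (mu : I -> {measure set (borel X) -> \bar R}) : \bar R :=
  \sum_(i : I) \sum_(j : I) (s i * s j)%:E * energy k (mu i) (mu j).

(* In [\bar R] a finite sum, or an integral, is finite only if all its terms,
   resp. the integrals of the positive and negative parts, are finite (an
   ill-defined sum +oo - oo evaluates to -oo). Hence [gauss ... \is a fin_num]
   also says that the functional is well defined. *)
Definition gauss (R : realType) (X : ptopologicalType)
    (k : X -> X -> \bar R) (I : finType) (s : I -> R) (f : I -> X -> \bar R)
    (mu : I -> {measure set (borel X) -> \bar R}) : \bar R :=
  vector_energy k s mu + 2%:E * \sum_(i : I) \int[mu i]_x f i x.

Definition admissible (R : realType) (X : ptopologicalType)
    (k : X -> X -> \bar R) (I : finType) (A : I -> set X) (s : I -> R)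
    (a : I -> R) (f : I -> X -> \bar R)
    (xi : I -> option {measure set (borel X) -> \bar R}) :
    set (I -> {measure set (borel X) -> \bar R}) :=
  [set mu | [/\ forall i, finite_energy_on k (A i) (mu i),
                forall i, mu i (A i) = (a i)%:E,
                forall i, if xi i is Some x then lem (mu i) x else True &
                gauss k s f mu \is a fin_num]].

Definition minimizers (R : realType) (X : ptopologicalType)
    (k : X -> X -> \bar R) (I : finType) (A : I -> set X) (s : I -> R)
    (a : I -> R) (f : I -> X -> \bar R)
    (xi : I -> option {measure set (borel X) -> \bar R}) :
    set (I -> {measure set (borel X) -> \bar R}) :=
  [set mu | admissible k A s a f xi mu /\
     forall nu, admissible k A s a f xi nu -> gauss k s f mu <= gauss k s f nu].

(* Main.v *)
(* The Gauss functional is convex along the segment joining two minimizers: by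
   the parallelogram law its value at their midpoint falls short of the minimum
   by a quarter of the energy of the signed measure
   [\sum_i s_i (mu^i - nu^i)]. The midpoint is admissible, so this energy is at
   most zero, and strict positive definiteness makes the signed measure vanish.
   Sets of zero capacity are null for measures of finite energy, so by essential
   disjointness the restriction to [A_i] minus the other plates isolates the
   i-th component. *)
Require Import Defs.
From HB Require Import structures.
From mathcomp Require Import all_boot all_order all_algebra.
From mathcomp Require Import all_classical all_reals all_analysis.
From mathcomp Require Import finmap measurable_realfun lra ring.

Set Implicit Arguments.
Unset Strict Implicit.
Unset Printing Implicit Defensive.

Import Order.TTheory GRing.Theory Num.Theory.

Local Open Scope classical_set_scope.
Local Open Scope ring_scope.
Local Open Scope ereal_scope.

(** * Second countability and Borel measurability of the kernel *)

Section second_countability.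
Context {R : realType} {X : ptopologicalType}.

(** Each compact set [K n] has a finite net at every scale [1/(m+1)]. The balls around the points of
    these nets form the basis, indexed by [n], [m] and the rank of the centre in its net. *)
Lemma metrizable_sigma_compact_basis : metrizable R X ->
  countable_at_infinity X -> exists B : nat * nat * nat -> set X,
    (forall i, open (B i)) /\
    forall x U, nbhs x U -> exists2 i, B i x & B i `<=` U.
Proof.
move=> [d [d0 dC dT dN]] [K cK KT].
have bO (c : X) (r : R) : open [set y | (d c y < r)%R].
  rewrite openE => y /= cy; apply/dN; exists (r - d c y)%R; first lra.
  by move=> z /= yz; have := dT c y z; lra.
have : forall nm : nat * nat, exists C : {fset X}, forall x, K nm.1 x ->
    exists2 c, c \in C & (d c x < nm.2.+1%:R^-1)%R.
  move=> [n m] /=; have := cK n; rewrite compact_cover.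
  move=> /(_ X setT (fun c => [set y | (d c y < m.+1%:R^-1)%R])) [].
  - by move=> c _; exact: bO.
  - by move=> x _; exists x => //=; have /d0 -> : x = x by [].
  - move=> C _ CK; exists C => x /CK[c cC cx]; by exists c.
move=> /choice[C CP].
(* A rank beyond the size of the net selects the default [point], which only adds a further open
   ball. *)
exists (fun p => [set y |
  (d (nth point (enum_fset (C p.1)) p.2) y < p.1.2.+1%:R^-1)%R]); split.
  by move=> p; exact: bO.
move=> x U /dN[e e0 eU].
have e20 : (0 < e / 2)%R by rewrite divr_gt0.
(* With a radius below [e / 2], any ball that contains [x] lies within distance [e] of [x]. *)
have [m] := @ltr_add_invr R 0%R (e / 2)%R e20; rewrite add0r => me.
have [n _ Kx] : (\bigcup_n K n) x by rewrite KT.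
have [c cC cx] := CP (n, m) x Kx.
have jP : nth point (enum_fset (C (n, m))) (index c (enum_fset (C (n, m)))) = c.
  exact: nth_index.
exists ((n, m), index c (enum_fset (C (n, m)))); rewrite /= jP //.
move=> y /= cy; apply: eU => /=.
move: (dT x c y) cx cy me; rewrite (dC x c) /=; move: (_.+1%:R^-1)%R => q; lra.
Qed.

(** The countable basis writes an open set of the product as a countable union of open rectangles,
    which lie in the product of the two Borel sigma-algebras. Rectangles not contained in [W] are
    replaced by the empty set. *)
Lemma open_prod_measurable : metrizable R X -> countable_at_infinity X ->
  forall W : set (X * X), open W ->
  measurable (W : set (borel X * borel X)%type).
Proof.
move=> /metrizable_sigma_compact_basis/[apply] -[B [oB BP]] W oW.
pose J := ((nat * nat * nat) * (nat * nat * nat))%type.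
have -> : (W : set (borel X * borel X)%type) = \bigcup_(p : J)
    if `[< B p.1 `*` B p.2 `<=` W >] then B p.1 `*` B p.2 else set0.
  apply/seteqP; split => [[x y] Wxy|z [p _]]; last first.
    by case: ifPn => // /asboolP; apply.
  have [[P Q] [Px Qy] PQW] : nbhs (x, y) W by exact: open_nbhs_nbhs.
  have [i Bix BiP] := BP _ _ Px; have [j Bjy BjQ] := BP _ _ Qy.
  exists (i, j) => //=; case: asboolP => // ijW; exfalso; apply: ijW.
  by move=> [u v] [/= /BiP Pu /BjQ Qv]; exact: PQW.
apply: countable_bigcupT_measurable => [|p]; first exact: countableP.
case: ifPn => // _.
by apply: measurableX; exact: sub_sigma_algebra.
Qed.

Lemma kernel_measurable (k : X -> X -> \bar R) :
  metrizable R X -> countable_at_infinity X -> is_kernel k ->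
  measurable_fun [set: (borel X * borel X)%type] (fun z => k z.1 z.2).
Proof.
move=> Xm Xc [_ _ /lower_semicontinuousP ko].
apply: (measurability _ (ErealGenOInfty.measurableE R)) => _ /= -[_ [r ->] <-].
rewrite setTI preimage_itvoy.
by apply: open_prod_measurable => //; exact: ko.
Qed.

End second_countability.

(** * Additivity of the integral with respect to the measure *)

(** This serves suprema over simple functions as well as suprema over compact sets. When [M] is
    finite, all terms and [ereal_sup S2] are finite too, so they can be moved across the inequality
    one at a time. *)
Lemma ereal_sup_addle (R : realType) (S1 S2 : set (\bar R)) (M : \bar R) :
  S1 !=set0 -> S2 !=set0 -> (forall x, S1 x -> 0 <= x) ->
  (forall x, S2 x -> 0 <= x) ->
  (forall x y, S1 x -> S2 y -> x + y <= M) ->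
  ereal_sup S1 + ereal_sup S2 <= M.
Proof.
move=> [x1 Sx1] [x2 Sx2] S1ge0 S2ge0 SM.
have M0 : 0 <= M.
  apply: (le_trans _ (SM _ _ Sx1 Sx2)).
  by apply: adde_ge0; [exact: S1ge0|exact: S2ge0].
have [->|Moo] := eqVneq M +oo; first by rewrite leey.
have Mfin : M \is a fin_num by rewrite ge0_fin_numE// ltey.
have fin1 x : S1 x -> x \is a fin_num.
  move=> Sx; rewrite ge0_fin_numE; last exact: S1ge0.
  apply: (@le_lt_trans _ _ M); last by rewrite ltey.
  by apply: (le_trans _ (SM _ _ Sx Sx2)); rewrite leeDl//; exact: S2ge0.
have sup2 x : S1 x -> ereal_sup S2 <= M - x.
  move=> Sx; apply: ge_ereal_sup => y Sy.
  by rewrite leeBrDr ?fin1// addeC SM.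
have sup2fin : ereal_sup S2 \is a fin_num.
  rewrite ge0_fin_numE.
    by apply: (le_lt_trans (sup2 _ Sx1)); rewrite ltey_eq fin_numB Mfin fin1.
  by apply: (le_trans (S2ge0 _ Sx2)); exact: ereal_sup_ubound.
rewrite -leeBrDr//; apply: ge_ereal_sup => x Sx.
by rewrite leeBrDr// addeC -leeBrDr ?fin1// sup2.
Qed.

Section nonmeasurable_integrand.
Context d (T : measurableType d) (R : realType).
Implicit Types (m : {measure set T -> \bar R}) (f : T -> \bar R).

Import HBNNSimple.

(* The library integral of a nonnegative function is a supremum over simple
   functions, directed under [\max]; hence measurability is not needed. *)
Lemma ge0_integral_measure_addT (m1 m2 : {measure set T -> \bar R}) f :
  (forall x, 0 <= f x) ->
  \int[measure_add m1 m2]_x f x = \int[m1]_x f x + \int[m2]_x f x.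
Proof.
move=> f0; apply/eqP; rewrite eq_le; apply/andP; split.
  rewrite [leLHS]ge0_integralTE//; apply: ge_ereal_sup => _ [h /= hf <-].
  have -> : sintegral (measure_add m1 m2) h = sintegral m1 h + sintegral m2 h.
    have := integral_measure_add_nnsfun m1 m2 measurableT h.
    by rewrite !integral_nnsfun// !patch_setT.
  rewrite !ge0_integralTE//.
  by apply: leeD; apply: ereal_sup_ubound; exists h.
rewrite [X in X + _]ge0_integralTE// [X in _ + X]ge0_integralTE//.
apply: ereal_sup_addle.
- by exists (sintegral m1 (@nnsfun0 _ T R)); exists nnsfun0.
- by exists (sintegral m2 (@nnsfun0 _ T R)); exists nnsfun0.
- by move=> _ [h _ <-]; exact: sintegral_ge0.
- by move=> _ [h _ <-]; exact: sintegral_ge0.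
move=> _ _ [g /= gf <-] [h /= hf <-].
pose M := max_nnsfun g h.
have Mf x : (M x)%:E <= f x.
  by rewrite /= /Order.max; case: ifP.
apply: (@le_trans _ _ (sintegral m1 M + sintegral m2 M)).
  by apply: leeD; apply: le_sintegral => x /=; rewrite le_max lexx ?orbT.
have -> : sintegral m1 M + sintegral m2 M = sintegral (measure_add m1 m2) M.
  have := integral_measure_add_nnsfun m1 m2 measurableT M.
  by rewrite !integral_nnsfun// !patch_setT.
rewrite [leRHS]ge0_integralTE//.
by apply: ereal_sup_ubound; exists M.
Qed.

Lemma integral_fin_num_parts m f : \int[m]_x f x \is a fin_num ->
  \int[m]_x f^\+ x \is a fin_num /\ \int[m]_x f^\- x \is a fin_num.
Proof.
rewrite integralE => h; have := h; rewrite fin_numB => /andP[].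
by split.
Qed.

(** This makes the field term affine at a midpoint. The measures are related in doubled form, so
    additivity in the measure suffices; it is applied to [f^\+] and [f^\-] separately, where all
    integrals are finite and can be subtracted. *)
Lemma integral_mean (m1 m2 : {measure set T -> \bar R}) m f :
  (forall B, measurable B -> m B + m B = m1 B + m2 B) ->
  \int[m1]_x f x \is a fin_num -> \int[m2]_x f x \is a fin_num ->
  \int[m]_x f x \is a fin_num /\
  \int[m]_x f x + \int[m]_x f x = \int[m1]_x f x + \int[m2]_x f x.
Proof.
move=> mE /integral_fin_num_parts[p1 n1] /integral_fin_num_parts[p2 n2].
have dbl g : (forall x, 0 <= g x) ->
    \int[m]_x g x + \int[m]_x g x = \int[m1]_x g x + \int[m2]_x g x.
  move=> g0; rewrite -!ge0_integral_measure_addT//.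
  apply: eq_measure_integral => A mA _.
  by move: (mE _ mA); rewrite -!measure_addE.
have dp := dbl _ (funepos_ge0 f); have dn := dbl _ (funeneg_ge0 f).
have half (u v : \bar R) : u + u = v -> v \is a fin_num -> u \is a fin_num.
  by move=> <-; rewrite fin_numD => /andP[].
have p : \int[m]_x f^\+ x \is a fin_num.
  by apply: half dp _; rewrite fin_numD p1.
have n : \int[m]_x f^\- x \is a fin_num.
  by apply: half dn _; rewrite fin_numD n1.
split; first by rewrite integralE fin_numB p n.
rewrite [\int[m]_x f x]integralE [\int[m1]_x f x]integralE.
rewrite [\int[m2]_x f x]integralE.
move: dp dn p n p1 n1 p2 n2.
move: (\int[m1]_x f^\+ x) (\int[m1]_x f^\- x).
move: (\int[m2]_x f^\+ x) (\int[m2]_x f^\- x).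
move: (\int[m]_x f^\+ x) (\int[m]_x f^\- x).
move=> [a| |] [b| |] [a2| |] [b2| |] [a1| |] [b1| |] //=.
rewrite -!EFinB -!EFinD => -[e1] [e2] _ _ _ _ _ _; congr (_%:E); lra.
Qed.

End nonmeasurable_integrand.

(** * Finite and Radon measures, and the Jordan decomposition of a difference *)

Section finite_measure_of.
Context d (T : measurableType d) (R : realType).
Variables (mu : {measure set T -> \bar R}) (mufin : mu setT < +oo).

(* The proof argument only serves to infer the [finite_measure] structure. *)
Definition finm of mu setT < +oo : set T -> \bar R := mu.

HB.instance Definition _ := Measure.on (finm mufin).

Let finm_fin_num_fun : fin_num_fun (finm mufin).
Proof. exact: (lty_fin_num_fun mufin). Qed.

HB.instance Definition _ := Measure_isFinite.Build _ _ _ (finm mufin)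
  finm_fin_num_fun.

End finite_measure_of.

Section radon_measures.
Context {R : realType} {X : ptopologicalType}.
Local Notation M := {measure set (borel X) -> \bar R}.
Implicit Types mu nu : M.

Definition addm mu nu : M := measure_add mu nu.

Lemma addmE mu nu B : addm mu nu B = mu B + nu B.
Proof. exact: measure_addE. Qed.

Lemma open_borel (U : set X) : open U -> measurable (U : set (borel X)).
Proof. exact: sub_sigma_algebra. Qed.

Lemma closed_borel (F : set X) : closed F -> measurable (F : set (borel X)).
Proof.
move=> cF; rewrite -(setCK F); apply: measurableC.
by apply: open_borel; exact: closed_openC.
Qed.

Lemma le_borel mu (A B : set (borel X)) : measurable A -> measurable B ->
  A `<=` B -> mu A <= mu B.
Proof. by move=> mA mB; apply: le_measure; exact: mem_set. Qed.

Lemma fin_num_finm mu B : mu setT < +oo -> measurable B -> mu B \is a fin_num.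
Proof. by move=> /lty_fin_num_fun; apply. Qed.

Lemma lem_lty mu nu : Defs.lem nu mu -> mu setT < +oo -> nu setT < +oo.
Proof. by move=> numu; apply: le_lt_trans; apply: numu. Qed.

Lemma lemDl mu nu : Defs.lem mu (addm mu nu).
Proof. by move=> B mB; rewrite addmE leeDl. Qed.

Lemma lemDr mu nu : Defs.lem nu (addm mu nu).
Proof. by move=> B mB; rewrite addmE leeDr. Qed.

Lemma addm_lty mu nu : mu setT < +oo -> nu setT < +oo -> addm mu nu setT < +oo.
Proof. by move=> ? ?; rewrite addmE lte_add_pinfty. Qed.

Hypothesis X_hausdorff : hausdorff_space X.

Lemma compact_borel (K : set X) : compact K -> measurable (K : set (borel X)).
Proof. by move=> /(compact_closed X_hausdorff)/closed_borel. Qed.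

Lemma ge_radon_sup mu (B : set (borel X)) : measurable B ->
  ereal_sup [set mu K | K in [set K : set X | compact K /\ K `<=` B]] <= mu B.
Proof.
move=> mB; apply: ge_ereal_sup => _ [K [cK KB] <-].
by apply: le_borel => //; exact: compact_borel.
Qed.

Lemma radonD mu nu : radon mu -> radon nu -> radon (addm mu nu).
Proof.
move=> [muK muB] [nuK nuB]; split.
  by move=> K cK; rewrite addmE lte_add_pinfty ?muK ?nuK.
move=> B mB; apply/eqP; rewrite eq_le ge_radon_sup// andbT.
rewrite addmE muB// nuB//; apply: ereal_sup_addle.
- by exists (mu set0); exists set0 => //; split => //; exact: compact0.
- by exists (nu set0); exists set0 => //; split => //; exact: compact0.
- by move=> _ [K _ <-].
- by move=> _ [K _ <-].
move=> _ _ [K [cK KB] <-] [L [cL LB] <-].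
(* The union is a single compact subset of [B] that serves both measures. *)
have cKL : compact (K `|` L) by exact: compactU.
apply: (@le_trans _ _ (addm mu nu (K `|` L))).
  have [mK mL] := (compact_borel cK, compact_borel cL).
  by rewrite addmE leeD// le_borel//; exact: measurableU.
apply: ereal_sup_ubound; exists (K `|` L) => //; split => //.
by move=> x [/KB|/LB].
Qed.

(** Inner regularity passes to the smaller measure: a compact [K] that exhausts [B] up to [e] for
    [mu] leaves [nu (B \ K) <= mu (B \ K) <= e]. *)
Lemma radon_le mu nu : radon mu -> mu setT < +oo -> Defs.lem nu mu -> radon nu.
Proof.
move=> [muK muB] mufin numu; split.
  move=> K cK; apply: le_lt_trans (muK K cK).
  by apply: numu; exact: compact_borel.
move=> B mB; apply/eqP; rewrite eq_le ge_radon_sup// andbT.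
apply/lee_addgt0Pr => e e0.
have muBfin := fin_num_finm mufin mB.
have : ereal_sup [set mu K | K in [set K : set X | compact K /\ K `<=` B]]
    \is a fin_num by rewrite -muB.
move=> /(ub_ereal_sup_adherent e0)[_ [K [cK KB] <-]]; rewrite -muB// => BK.
have mK := compact_borel cK.
apply: (@le_trans _ _ (nu K + e%:E)); last first.
  by rewrite leeD2r//; apply: ereal_sup_ubound; exists K.
have -> : nu B = nu K + nu (B `\` K).
  by rewrite -measureU// ?setDUK//; [exact: measurableD|rewrite setDIK].
rewrite leeD2l//; apply: le_trans (numu _ (measurableD mB mK)) _.
rewrite measureD//; last by rewrite ltey_eq muBfin.
rewrite setIidr// leeBlDr ?fin_num_finm//.
by rewrite addeC -leeBlDr//; exact: ltW.
Qed.

(** Here [p] and [n] are the Jordan parts of the charge [mu - nu], and [m] is the infimum of [mu]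
    and [nu]. *)
Lemma jordan_parts mu nu : mu setT < +oo -> nu setT < +oo ->
  exists p n m : M, [/\ exists P : set (borel X),
      [/\ measurable P, p (~` P) = 0 & n P = 0],
    eqm mu (addm p m) & eqm nu (addm n m)].
Proof.
move=> mufin nufin.
pose s : {charge set (borel X) -> \bar R} :=
  cadd (charge_of_finite_measure (finm mufin))
       (copp (charge_of_finite_measure (finm nufin))).
have sE B : s B = mu B - nu B by [].
have [P [N PN]] := Hahn_decomposition s.
have [[mP _] [mN _] PNT PN0] := PN.
pose p : M := jordan_pos PN; pose n : M := jordan_neg PN.
(* On the positive set [P] the smaller of the two measures is [nu]; on the negative set [N] it is
   [mu]. *)
exists p, n, (addm (mrestr nu mP) (mrestr mu mN)).
have pE B : measurable B -> p B = mu (B `&` P) - nu (B `&` P).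
  move=> mB; rewrite -[p B]/(jordan_pos PN B) jordan_posE cjordan_posE.
  by rewrite /crestr0 mem_set.
have nE B : measurable B -> n B = nu (B `&` N) - mu (B `&` N).
  move=> mB; rewrite -[n B]/(jordan_neg PN B) jordan_negE cjordan_negE.
  rewrite /crestr0 mem_set//= /crestr sE.
  by rewrite fin_num_oppeB ?fin_num_finm//; [rewrite addeC|exact: measurableI..].
have cut (l : M) B : measurable B -> l B = l (B `&` P) + l (B `&` N).
  move=> mB; rewrite -measureU//; [|exact: measurableI..|].
    by rewrite -setIUr PNT setIT.
  by rewrite setIACA PN0 setI0.
split.
- exists P; split => //.
    by rewrite pE; [rewrite setICl !measure0 sube0|exact: measurableC].
  by rewrite nE// PN0 !measure0 sube0.
- move=> B mB; rewrite !addmE pE// /= /mrestr addeA subeK; first exact: cut.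
  by rewrite fin_num_finm//; exact: measurableI.
- move=> B mB; rewrite !addmE nE// /= /mrestr [X in _ + X]addeC addeA subeK.
    by rewrite addeC; exact: cut.
  by rewrite fin_num_finm//; exact: measurableI.
Qed.

End radon_measures.

(** * The mutual energy as a symmetric, additive and monotone form *)

Section energy_form.
Context {R : realType} {X : ptopologicalType} (k : X -> X -> \bar R).
Local Notation M := {measure set (borel X) -> \bar R}.
Implicit Types mu nu : M.
Hypothesis k_ge0 : forall x y, 0 <= k x y.
Hypothesis kC : forall x y, k x y = k y x.
Hypothesis k_measurable :
  measurable_fun [set: (borel X * borel X)%type] (fun z => k z.1 z.2).

Let section_measurable (x : X) : measurable_fun [set: borel X] (k x).
Proof.
exact: (measurableT_comp k_measurable (measurable_pair1 (x : borel X))).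
Qed.

Let potential_measurable nu : nu setT < +oo ->
  measurable_fun [set: borel X] (fun x => \int[nu]_y k x y).
Proof.
move=> nufin.
exact: (@measurable_fun_fubini_tonelli_F _ _ (borel X) (borel X) R
  (finm nufin) (fun z => k z.1 z.2)).
Qed.

Let potential_ge0 nu x : 0 <= \int[nu]_y k x y.
Proof. exact: integral_ge0. Qed.

Lemma energy_ge0 mu nu : 0 <= energy k mu nu.
Proof. exact: integral_ge0. Qed.

Lemma eq_energy mu mu' nu nu' : eqm mu mu' -> eqm nu nu' ->
  energy k mu nu = energy k mu' nu'.
Proof.
move=> mumu' nunu'; rewrite /energy (eq_measure_integral mu'); last first.
  by move=> A mA _; exact: mumu'.
apply: eq_integral => x _; apply: eq_measure_integral => A mA _.
exact: nunu'.
Qed.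

Lemma energyC mu nu : mu setT < +oo -> nu setT < +oo ->
  energy k mu nu = energy k nu mu.
Proof.
move=> mufin nufin.
rewrite /energy (@fubini_tonelli _ _ (borel X) (borel X) R
  (finm mufin) (finm nufin) (fun z => k z.1 z.2))//=.
by apply: eq_integral => y _; apply: eq_integral => x _; rewrite kC.
Qed.

Lemma energyDl mu1 mu2 nu :
  energy k (addm mu1 mu2) nu = energy k mu1 nu + energy k mu2 nu.
Proof. by rewrite /energy ge0_integral_measure_addT. Qed.

Lemma energyDr mu nu1 nu2 : nu1 setT < +oo -> nu2 setT < +oo ->
  energy k mu (addm nu1 nu2) = energy k mu nu1 + energy k mu nu2.
Proof.
move=> fin1 fin2; rewrite /energy -ge0_integralD//;
  try exact: potential_measurable.
by apply: eq_integral => x _; rewrite ge0_integral_measure_addT.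
Qed.

Lemma energy0l nu : energy k (mzero : M) nu = 0.
Proof. exact: integral_measure_zero. Qed.

Lemma le_energy mu mu' nu nu' : nu' setT < +oo ->
  Defs.lem mu mu' -> Defs.lem nu nu' -> energy k mu nu <= energy k mu' nu'.
Proof.
move=> nu'fin mumu' nunu'.
have nufin := lem_lty nunu' nu'fin.
apply: (@le_trans _ _ (energy k mu nu')).
  apply: ge0_le_integral => //; try exact: potential_measurable.
  by move=> x _; exact: ge0_le_measure_integral.
by apply: ge0_le_measure_integral => //; exact: potential_measurable.
Qed.

End energy_form.

(** * Measures of finite energy for a strictly positive definite kernel *)

Section finite_energy_measures.
Context {R : realType} {X : ptopologicalType} (k : X -> X -> \bar R).
Local Notation M := {measure set (borel X) -> \bar R}.
Implicit Types mu nu : M.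
Hypothesis X_hausdorff : hausdorff_space X.
Hypothesis k_ge0 : forall x y, 0 <= k x y.
Hypothesis kC : forall x y, k x y = k y x.
Hypothesis k_measurable :
  measurable_fun [set: (borel X * borel X)%type] (fun z => k z.1 z.2).
Hypothesis k_spd : strictly_positive_definite k.

(** Finite total mass is included because Tonelli's theorem and the Hahn decomposition are applied
    to these measures. Components of admissible families have it, being carried by a plate of
    prescribed mass. *)
Definition finite_energy mu :=
  [/\ radon mu, mu setT < +oo & energy k mu mu < +oo].

(** An infinite energy would be sent to 0, so this value is meaningful only once [spd_energy_sub]
    has given finiteness. *)
Definition renergy mu nu : R := fine (energy k mu nu).

Lemma finite_energy_le mu nu : finite_energy mu -> Defs.lem nu mu ->
  finite_energy nu.
Proof.
move=> [rmu mufin emu] numu; split.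
- exact: (radon_le X_hausdorff rmu mufin numu).
- exact: lem_lty numu mufin.
- exact: le_lt_trans (le_energy k_ge0 k_measurable mufin numu numu) emu.
Qed.

Let energy_fin_num mu nu : energy k mu nu < +oo -> energy k mu nu \is a fin_num.
Proof. by move=> h; rewrite ge0_fin_numE// energy_ge0. Qed.

(* The energy of [mu - nu] is that of its Jordan decomposition [p - n]: the
   common part [m] of [mu] and [nu] cancels. *)
Lemma spd_energy_sub mu nu : finite_energy mu -> finite_energy nu ->
  energy k mu nu < +oo /\
  ((renergy mu mu + renergy nu nu - renergy mu nu *+ 2 <= 0)%R -> eqm mu nu).
Proof.
move=> gmu gnu; have [_ mufin emu] := gmu; have [_ nufin enu] := gnu.
have [p [n [m [sing mupm nunm]]]] := jordan_parts mufin nufin.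
have p_mu : Defs.lem p mu by move=> B mB; rewrite mupm//; exact: lemDl.
have m_mu : Defs.lem m mu by move=> B mB; rewrite mupm//; exact: lemDr.
have n_nu : Defs.lem n nu by move=> B mB; rewrite nunm//; exact: lemDl.
have m_nu : Defs.lem m nu by move=> B mB; rewrite nunm//; exact: lemDr.
have [rp pfin epp] := finite_energy_le gmu p_mu.
have [rn nfin enn] := finite_energy_le gnu n_nu.
have [rm mfin emm] := finite_energy_le gmu m_mu.
have le_en := le_energy k_ge0 k_measurable.
have epm : energy k p m < +oo :=
  le_lt_trans (le_en _ _ _ _ mufin p_mu m_mu) emu.
have enm : energy k n m < +oo :=
  le_lt_trans (le_en _ _ _ _ nufin n_nu m_nu) enu.
have eC := energyC k_ge0 kC k_measurable.
have Dr := energyDr k_ge0 k_measurable; have Dl := energyDl k_ge0.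
pose s := SignedRadon rp rn sing.
have sdef : senergy_defined k s s by left; rewrite /senergy_plus lte_add_pinfty.
have [s_ge0 s_gt0] := k_spd sdef.
have splus : senergy_plus k s s = energy k p p + energy k n n by [].
have sminus : senergy_minus k s s = energy k p n + energy k p n.
  by rewrite /senergy_minus /= (eC n p).
(* The energies of [p] and [n] are finite, so an infinite mutual energy would make the energy of [s]
   equal to [-oo], against positive definiteness. *)
have epn : energy k p n < +oo.
  rewrite ltey; apply/eqP => epn; move: s_ge0.
  by rewrite /senergy sminus epn splus /= addeNy.
have [fpp fnn fmm] := And3 (energy_fin_num epp) (energy_fin_num enn)
  (energy_fin_num emm).
have [fpm fnm fpn] := And3 (energy_fin_num epm) (energy_fin_num enm)
  (energy_fin_num epn).
have munuE : energy k mu nu =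
    energy k p n + energy k n m + (energy k p m + energy k m m).
  rewrite (eq_energy k mupm nunm) Dr// !Dl//.
  by rewrite (eC m n).
have mumuE : energy k mu mu =
    energy k p p + energy k p m + (energy k p m + energy k m m).
  by rewrite (eq_energy k mupm mupm) Dr// !Dl// (eC m p).
have nunuE : energy k nu nu =
    energy k n n + energy k n m + (energy k n m + energy k m m).
  by rewrite (eq_energy k nunm nunm) Dr// !Dl// (eC m n).
split; first by rewrite munuE; do ![apply: lte_add_pinfty => //].
move=> le0.
have sE : senergy k s s =
    (renergy mu mu + renergy nu nu - renergy mu nu *+ 2)%:E.
  rewrite /senergy splus sminus /renergy munuE mumuE nunuE.
  move: fpp fnn fmm fpm fnm fpn.
  move: (energy k p p) (energy k n n) (energy k m m) => [a| |] [b| |] [c| |] //.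
  move: (energy k p m) (energy k n m) (energy k p n) => [u| |] [v| |] [w| |] //.
  by move=> *; rewrite -!EFinD /=; congr (_%:E); ring.
have [p0 n0] : sr_zero s.
  apply: contrapT => /s_gt0; rewrite sE lte_fin => lt0.
  by move: (lt_le_trans lt0 le0); rewrite ltxx.
move=> B mB; rewrite mupm// nunm// !addmE.
have null (l : M) : l setT = 0 -> l B = 0.
  by move=> l0; apply/eqP; rewrite eq_le measure_ge0 andbT -l0 le_borel.
by rewrite (null p p0) (null n n0).
Qed.

(** Positive definiteness enters through the cross terms, which are finite by [spd_energy_sub]. *)
Lemma finite_energyD mu nu : finite_energy mu -> finite_energy nu ->
  finite_energy (addm mu nu).
Proof.
move=> gmu gnu; have [emn _] := spd_energy_sub gmu gnu.
have [enm _] := spd_energy_sub gnu gmu.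
have [[rmu mufin emu] [rnu nufin enu]] := (gmu, gnu).
split; [exact: radonD|exact: addm_lty|].
rewrite (energyDr k_ge0 k_measurable)// !(energyDl k_ge0)//.
by do ![apply: lte_add_pinfty => //].
Qed.

Lemma finite_energy0 : finite_energy (mzero : M).
Proof.
split; [|by rewrite ltry|by rewrite energy0l ltry].
split=> [K _|B mB]; first by rewrite ltry.
apply/eqP; rewrite eq_le (ge_radon_sup X_hausdorff)// andbT.
by apply: ereal_sup_ubound; exists set0 => //; split => //; exact: compact0.
Qed.

Lemma renergyDl mu1 mu2 nu : finite_energy mu1 -> finite_energy mu2 ->
  finite_energy nu ->
  renergy (addm mu1 mu2) nu = (renergy mu1 nu + renergy mu2 nu)%R.
Proof.
move=> g1 g2 gn.
have [/energy_fin_num f1 _] := spd_energy_sub g1 gn.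
have [/energy_fin_num f2 _] := spd_energy_sub g2 gn.
by rewrite /renergy (energyDl k_ge0)// fineD.
Qed.

Lemma renergyC mu nu : finite_energy mu -> finite_energy nu ->
  renergy mu nu = renergy nu mu.
Proof.
move=> [_ ? _] [_ ? _].
by rewrite /renergy (energyC k_ge0 kC k_measurable).
Qed.

Lemma renergyDr mu nu1 nu2 : finite_energy mu -> finite_energy nu1 ->
  finite_energy nu2 ->
  renergy mu (addm nu1 nu2) = (renergy mu nu1 + renergy mu nu2)%R.
Proof.
move=> g g1 g2; rewrite renergyC ?renergyDl//; last exact: finite_energyD.
by rewrite (renergyC g1) ?(renergyC g2).
Qed.

(** * Finite sums of measures of finite energy *)

Section sums.
Context {J : Type}.
Implicit Types (g h : J -> M) (s t : seq J).

Definition summ g s : M := foldr (fun i m => addm (g i) m) (mzero : M) s.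

Lemma summE g s B : summ g s B = \sum_(i <- s) g i B.
Proof.
elim: s => [|i s IH]; first by rewrite big_nil.
by rewrite big_cons /= addmE IH.
Qed.

Lemma finite_energy_summ g s : (forall i, finite_energy (g i)) ->
  finite_energy (summ g s).
Proof.
move=> gg; elim: s => [|i s IH]; first exact: finite_energy0.
exact: finite_energyD.
Qed.

Lemma renergy_suml g s nu : (forall i, finite_energy (g i)) ->
  finite_energy nu ->
  renergy (summ g s) nu = (\sum_(i <- s) renergy (g i) nu)%R.
Proof.
move=> gg gn; elim: s => [|i s IH].
  by rewrite big_nil /renergy energy0l.
by rewrite big_cons /= renergyDl ?IH//; exact: finite_energy_summ.
Qed.

Lemma renergy_sum g h s : (forall i, finite_energy (g i)) ->
  (forall i, finite_energy (h i)) -> renergy (summ g s) (summ h s) =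
  (\sum_(i <- s) \sum_(j <- s) renergy (g i) (h j))%R.
Proof.
move=> gg gh; rewrite renergy_suml//; last exact: finite_energy_summ.
apply: eq_bigr => i _; rewrite renergyC//; last exact: finite_energy_summ.
by rewrite renergy_suml//; apply: eq_bigr => j _; exact: renergyC.
Qed.

End sums.

(** * Sets of zero capacity, and midpoints of measures *)

(** If [mu Q] were positive, the normalized restriction of [mu] to [Q] would compete in the infimum
    defining the capacity with finite energy, whereas that infimum is [+oo]. *)
Lemma capacity0_null (Q : set X) mu : measurable (Q : set (borel X)) ->
  capacity k Q = 0 -> finite_energy mu -> mu Q = 0.
Proof.
move=> mQ /eqP; rewrite inve_eq0 => /eqP inf_oo gmu.
have [_ mufin _] := gmu; have Qfin := fin_num_finm mufin mQ.
apply/eqP; apply/negP => /negP muQ0.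
have rE : mu Q = (fine (mu Q))%:E by rewrite fineK.
have r0 : (0 < fine (mu Q))%R.
  by rewrite fine_gt0// ltey_eq Qfin andbT lt0e muQ0 measure_ge0.
have c0 : (0 <= (fine (mu Q))^-1)%R by rewrite invr_ge0 ltW.
pose nu : M := mscale (NngNum c0) (mrestr mu mQ).
have nuE B : nu B = ((fine (mu Q))^-1)%:E * mu (B `&` Q) by [].
have gnu : finite_energy nu.
  (* As [N] exceeds the scaling factor, [nu] is dominated by the sum of [N] copies of [mu], and
     finite energy is stable under sums and domination. *)
  pose N := (Num.truncn (fine (mu Q))^-1).+1.
  apply: (@finite_energy_le (summ (fun=> mu) (iota 0 N))).
    exact: finite_energy_summ.
  move=> B mB; rewrite nuE summE.
  have -> : \sum_(i <- iota 0 N) mu B = N%:R%:E * mu B.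
    have /fineK <- := fin_num_finm mufin mB.
    rewrite sumEFin -EFinM big_const_seq iter_addr_0.
    by rewrite count_predT size_iota mulr_natl.
  apply: lee_pmul => //; first by rewrite lee_fin ltW// truncnS_gt.
  by apply: le_borel => //; exact: measurableI.
have [rnu nufin enu] := gnu.
have : ereal_inf [set energy k m m | m in
    [set m | finite_energy_on k Q m /\ m Q = 1]] <= energy k nu nu.
  apply: ereal_inf_lbound; exists nu => //; split.
    split => //; split => //; apply/negligibleP; first exact: measurableC.
    by rewrite [LHS]nuE setICl measure0 mule0.
  by rewrite [LHS]nuE setIid [X in _ * X]rE -EFinM mulVf// gt_eqF.
by rewrite inf_oo leye_eq => /eqP enuy; move: enu; rewrite enuy ltxx.
Qed.

Definition midm mu nu : M := mscale (2^-1%:nng)%R (addm mu nu).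

(** Later uses of the midpoint go through this doubled identity, so that scalar factors need not be
    carried through energies and integrals. *)
Lemma midmE mu nu B : midm mu nu B + midm mu nu B = mu B + nu B.
Proof.
rewrite -[midm mu nu B]/((2^-1)%R%:E * addm mu nu B) addmE.
by rewrite -ge0_muleDl ?lee_fin// -EFinD (_ : 2^-1 + 2^-1 = 1)%R ?mul1e//; lra.
Qed.

Lemma midm_finite_energy mu nu : finite_energy mu -> finite_energy nu ->
  finite_energy (midm mu nu).
Proof.
move=> gmu gnu; apply: finite_energy_le (finite_energyD gmu gnu) _ => B mB.
by rewrite addmE -midmE leeDl.
Qed.

Lemma midm_renergy mu mu' nu nu' : finite_energy mu -> finite_energy mu' ->
  finite_energy nu -> finite_energy nu' ->
  (renergy (midm mu mu') (midm nu nu') *+ 4 = renergy mu nu + renergy mu nu' +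
   renergy mu' nu + renergy mu' nu')%R.
Proof.
move=> g1 g2 g3 g4.
have g12 := midm_finite_energy g1 g2; have g34 := midm_finite_energy g3 g4.
set u := midm mu mu' in g12 *; set v := midm nu nu' in g34 *.
have -> : (renergy u v *+ 4)%R = renergy (addm u u) (addm v v).
  rewrite renergyDl ?renergyDr//; last exact: finite_energyD.
  by ring.
have -> : renergy (addm u u) (addm v v) = renergy (addm mu mu') (addm nu nu').
  by congr fine; apply: eq_energy => B mB; rewrite !addmE midmE.
by rewrite renergyDl ?renergyDr//; [ring|exact: finite_energyD].
Qed.

(** * Isolating the components on essentially disjoint plates *)

Section condenser.
Context {I : finType} (A : I -> set X) (s : I -> R).
Hypothesis A_condenser : generalized_condenser A s.
Hypothesis A_ess_disjoint : forall i j, i != j -> capacity k (A i `&` A j) = 0.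
Implicit Types (m : I -> M).

Lemma condenser_borel i : measurable (A i : set (borel X)).
Proof.
have [U [F [oU cF ->]]] := gc_locally_closed A_condenser i.
by apply: measurableI; [exact: open_borel|exact: closed_borel].
Qed.

Lemma carried_null mu i : carried_by (A i) mu -> mu (~` A i) = 0.
Proof.
by move/negligibleP => -> //; apply: measurableC; exact: condenser_borel.
Qed.

Lemma finite_energy_on_finite mu i (r : R) : finite_energy_on k (A i) mu ->
  mu (A i) = r%:E -> finite_energy mu.
Proof.
move=> [[rmu /carried_null cmu] emu] muA; split => //.
have mA := condenser_borel i.
have -> : mu setT = mu (A i) + mu (~` A i).
  rewrite -measureU//; [by rewrite setUv|exact: measurableC|exact: setICr].
by rewrite cmu adde0 muA ltry.
Qed.

Definition other_plates i : set X := \big[setU/set0]_(j | j != i) A j.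

Lemma other_plates_borel i : measurable (other_plates i : set (borel X)).
Proof. by apply: bigsetU_measurable => j _; exact: condenser_borel. Qed.

Lemma other_plates_null mu i : finite_energy mu ->
  mu (A i `&` other_plates i) = 0.
Proof.
move=> gmu; have mA := condenser_borel.
(* The induction over the plates carries along the measurability of the partial unions. *)
suff [] : measurable (other_plates i : set (borel X)) /\
  mu (A i `&` other_plates i) = 0 by [].
rewrite /other_plates; elim/big_rec : _ => [|j U ji [mU U0]].
  by rewrite setI0 measure0.
split; first exact: measurableU.
rewrite setIUr measureU0//; try exact: measurableI.
apply: capacity0_null => //; first exact: measurableI.
by apply: A_ess_disjoint; rewrite eq_sym.
Qed.

(** What is cut off lies outside [A i] or in its overlap with the other plates. Both are null, the
    first by the carrier and the second by zero capacity. *)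
Lemma essential_part mu i (B : set (borel X)) : finite_energy mu ->
  carried_by (A i) mu -> measurable B ->
  mu B = mu (B `&` (A i `\` other_plates i)).
Proof.
move=> gmu /carried_null cmu mB.
have [mA mO] := (condenser_borel i, other_plates_borel i).
have mAO : measurable (A i `\` other_plates i : set (borel X)).
  exact: measurableD.
rewrite -[in LHS](setUIDK B (A i `\` other_plates i)) measureU0//.
- exact: measurableI.
- exact: measurableD.
apply/eqP; rewrite -measure_le0.
apply: (@le_trans _ _ (mu (~` A i `|` (A i `&` other_plates i)))).
  apply: le_borel; [exact: measurableD| |].
    by apply: measurableU; [exact: measurableC|exact: measurableI].
  move=> x [_ nAO]; have [Ax|] := pselect (A i x); last by left.
  by right; split => //; apply: contrapT => nO; apply: nAO.
rewrite measureU0//; [by rewrite cmu|exact: measurableC|exact: measurableI|].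
exact: other_plates_null.
Qed.

(** The plate [A j] is one of those removed from [A i], so the set lies in the complement of a
    carrier of [mu]. *)
Lemma foreign_part mu i j (B : set (borel X)) : j != i ->
  carried_by (A j) mu -> measurable B ->
  mu (B `&` (A i `\` other_plates i)) = 0.
Proof.
move=> ji /carried_null cmu mB.
have [mA mO] := (condenser_borel i, other_plates_borel i).
apply/eqP; rewrite -measure_le0 -cmu; apply: le_borel.
- by apply: measurableI => //; exact: measurableD.
- by apply: measurableC; exact: condenser_borel.
move=> x [_ [_ nO]] Ajx; apply: nO.
by rewrite /other_plates (bigD1 j)//=; left.
Qed.

(** * Convexity of the Gauss functional and uniqueness of the minimizer *)

Section gauss_functional.
Context (a : I -> R) (f : I -> X -> \bar R) (xi : I -> option M).

Definition rvector_energy m : R :=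
  (\sum_(i : I) \sum_(j : I) s i * s j * renergy (m i) (m j))%R.

Lemma energyE mu nu : finite_energy mu -> finite_energy nu ->
  energy k mu nu = (renergy mu nu)%:E.
Proof.
by move=> gmu gnu; have [/energy_fin_num/fineK <-] := spd_energy_sub gmu gnu.
Qed.

Lemma vector_energyE m : (forall i, finite_energy (m i)) ->
  vector_energy k s m = (rvector_energy m)%:E.
Proof.
move=> gm; rewrite /rvector_energy -sumEFin; apply: eq_bigr => i _.
by rewrite -sumEFin; apply: eq_bigr => j _; rewrite energyE.
Qed.

Lemma gauss_field_fin_num m : gauss k s f m \is a fin_num ->
  forall i, \int[m i]_x f i x \is a fin_num.
Proof.
rewrite /gauss fin_numD => /andP[_] h i.
have : \sum_(j : I) \int[m j]_x f j x \is a fin_num.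
  move: h; move: (\sum_(j : I) _) => [r| |] //.
    by rewrite gt0_muley// lte_fin.
  by rewrite gt0_muleNy// lte_fin.
by move=> /sum_fin_numP; apply => //; rewrite mem_index_enum.
Qed.

Lemma gaussE m : (forall i, finite_energy (m i)) ->
  (forall i, \int[m i]_x f i x \is a fin_num) ->
  gauss k s f m =
  (rvector_energy m + 2 * \sum_(i : I) fine (\int[m i]_x f i x))%R%:E.
Proof.
move=> gm fm; rewrite /gauss vector_energyE// [RHS]EFinD [X in _ = _ + X]EFinM.
by congr (_ + _ * _); rewrite -sumEFin; apply: eq_bigr => i _; rewrite fineK.
Qed.

(* [\sum_i s i (m i - m' i)] is the difference of the two positive measures
   [\sum_i plus m m' i] and [\sum_i plus m' m i]. *)
Definition plus m m' (i : I) : M := if s i == 1%R then m i else m' i.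

Definition total m : M := summ m (index_enum I).

Lemma plus_finite_energy m m' : (forall i, finite_energy (m i)) ->
  (forall i, finite_energy (m' i)) -> forall i, finite_energy (plus m m' i).
Proof. by move=> gm gm' i; rewrite /plus; case: ifP. Qed.

(** This is the parallelogram law: four times the midpoint energy is the energy of the sum, and the
    right-hand side is the energy of the difference, written with positive measures only. *)
Lemma total_energy m m' : (forall i, finite_energy (m i)) ->
  (forall i, finite_energy (m' i)) ->
  (rvector_energy m *+ 2 + rvector_energy m' *+ 2 -
   rvector_energy (fun i => midm (m i) (m' i)) *+ 4)%R =
  (renergy (total (plus m m')) (total (plus m m')) +
   renergy (total (plus m' m)) (total (plus m' m)) -
   renergy (total (plus m m')) (total (plus m' m)) *+ 2)%R.
Proof.
move=> gm gm'.
have gp := plus_finite_energy gm gm'; have gn := plus_finite_energy gm' gm.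
have gtot g : (forall i, finite_energy (g i)) -> finite_energy (total g).
  exact: finite_energy_summ.
(* Symmetrizing the cross term makes the two sides agree for each pair [i], [j], which leaves a
   check over the signs. *)
have -> : (renergy (total (plus m m')) (total (plus m' m)) *+ 2 =
    renergy (total (plus m m')) (total (plus m' m)) +
    renergy (total (plus m' m)) (total (plus m m')))%R.
  by rewrite (renergyC (gtot _ gn) (gtot _ gp)) mulr2n.
rewrite /total !renergy_sum// /rvector_energy -!sumrMnl -!big_split -!sumrB.
apply: eq_bigr => i _; rewrite -!sumrMnl -!big_split -!sumrB.
apply: eq_bigr => j _ /=.
rewrite -[(_ *+ 4)%R]mulrnAr midm_renergy// /plus.
have N11 : (-1 == 1 :> R)%R = false by apply: lt_eqF; lra.
by case: (gc_sign A_condenser i) => ->; case: (gc_sign A_condenser j) => ->;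
  rewrite ?eqxx ?N11; ring.
Qed.

Lemma admissible_finite_energy m : admissible k A s a f xi m ->
  forall i, finite_energy (m i).
Proof.
by case=> em am _ _ i; exact: (finite_energy_on_finite (em i) (am i)).
Qed.

Lemma admissible_mid m m' : admissible k A s a f xi m ->
  admissible k A s a f xi m' ->
  admissible k A s a f xi (fun i => midm (m i) (m' i)).
Proof.
move=> adm adm'; have gm := admissible_finite_energy adm.
have gm' := admissible_finite_energy adm'.
have [em am xim Gm] := adm; have [em' am' xim' Gm'] := adm'.
have gw i := midm_finite_energy (gm i) (gm' i).
split.
- move=> i; have [rw wfin ew] := gw i; split => //; split => //.
  have mAC : measurable (~` A i : set (borel X)).
    by apply: measurableC; exact: condenser_borel.
  apply/negligibleP => //; apply/eqP; rewrite -measure_le0.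
  have [[[_ cm] _] [[_ cm'] _]] := (em i, em' i).
  apply: (@le_trans _ _ (m i (~` A i) + m' i (~` A i))).
    by rewrite -midmE leeDl.
  by rewrite (carried_null cm) (carried_null cm') adde0.
- move=> i; have := midmE (m i) (m' i) (A i); rewrite am am'.
  move: (midm _ _ _) => [r| |] //.
  by rewrite -!EFinD => -[rr]; congr (_%:E); lra.
- move=> i; have := xim i; have := xim' i; case: (xi i) => // x lem_m' lem_m.
  (* Doubling a violation at the midpoint would give [x B + x B < m i B + m' i B], against the
     constraints on [m] and [m']. *)
  move=> B mB; rewrite leNgt; apply/negP => lt_x.
  have := lteD lt_x lt_x; rewrite midmE ltNge => /negP; apply.
  by apply: leeD; [exact: lem_m|exact: lem_m'].
rewrite gaussE// => i.
by apply: (integral_mean _ (gauss_field_fin_num Gm i)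
  (gauss_field_fin_num Gm' i)).1 => B _; exact: midmE.
Qed.

Lemma minimizers_total m m' : minimizers k A s a f xi m ->
  minimizers k A s a f xi m' ->
  eqm (total (plus m m')) (total (plus m' m)).
Proof.
move=> [adm minm] [adm' minm'].
have gm := admissible_finite_energy adm.
have gm' := admissible_finite_energy adm'.
have [_ _ _ Gm] := adm; have [_ _ _ Gm'] := adm'.
have admw := admissible_mid adm adm'; have [_ _ _ Gw] := admw.
have gw := admissible_finite_energy admw.
have fm := gauss_field_fin_num Gm; have fm' := gauss_field_fin_num Gm'.
have fw := gauss_field_fin_num Gw.
have := minm _ admw; have := minm' _ admw.
rewrite !gaussE// !lee_fin => le1 le2.
(* The field term is affine, so it cancels when the two comparisons with the midpoint are added. *)
have fieldE : ((\sum_(i : I) fine (\int[midm (m i) (m' i)]_x f i x)) *+ 2 =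
    \sum_(i : I) fine (\int[m i]_x f i x) +
    \sum_(i : I) fine (\int[m' i]_x f i x))%R.
  rewrite -sumrMnl -big_split; apply: eq_bigr => i _.
  rewrite mulr2n -(fineD (fw i) (fw i)) -[RHS](fineD (fm i) (fm' i)).
  congr fine.
  by apply: (integral_mean _ (fm i) (fm' i)).2 => B _; exact: midmE.
have gtot g : (forall i, finite_energy (g i)) -> finite_energy (total g).
  exact: finite_energy_summ.
have gp := gtot _ (plus_finite_energy gm gm').
have gn := gtot _ (plus_finite_energy gm' gm).
have [_ sub0] := spd_energy_sub gp gn.
apply: sub0; rewrite -total_energy//.
(* Twice the sum of [le1] and [le2] bounds the left-hand side of the parallelogram law by 0. *)
by move: fieldE le1 le2; rewrite !mulr2n; lra.
Qed.

Lemma minimizers_unique m m' : minimizers k A s a f xi m ->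
  minimizers k A s a f xi m' -> forall i, eqm (m i) (m' i).
Proof.
move=> minm minm' i B mB.
have [adm _] := minm; have [adm' _] := minm'.
have gm := admissible_finite_energy adm.
have gm' := admissible_finite_energy adm'.
have cm j : carried_by (A j) (m j) by have [/(_ j)[[]]] := adm.
have cm' j : carried_by (A j) (m' j) by have [/(_ j)[[]]] := adm'.
rewrite (essential_part (gm i) (cm i) mB) (essential_part (gm' i) (cm' i) mB).
set D := B `&` _.
have mD : measurable D.
  by apply: measurableI => //; apply: measurableD;
    [exact: condenser_borel|exact: other_plates_borel].
have := minimizers_total minm minm' mD.
(* On [D] every summand but the [i]-th vanishes. The sign of [i] then only decides which side of the
   equality carries [m i]. *)
have single g g' : (forall j, carried_by (A j) (g j)) ->
    (forall j, carried_by (A j) (g' j)) ->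
    total (plus g g') D = plus g g' i D.
  move=> cg cg'; rewrite /total summE (bigD1 i)//= big1 ?adde0// => j ji.
  by rewrite /plus; case: ifP => _; apply: (@foreign_part _ i j).
by rewrite !single// /plus; case: ifP => _ // ->.
Qed.

End gauss_functional.
End condenser.
End finite_energy_measures.

Theorem corollary3p13 (R : realType) (X : ptopologicalType)
    (X_lc : locally_compact [set: X])
    (X_hausdorff : hausdorff_space X)
    (X_metrizable : metrizable R X)
    (X_countable : countable_at_infinity X)
    (k : X -> X -> \bar R)
    (k_kernel : is_kernel k)
    (k_spd : strictly_positive_definite k)
    (I : finType) (A : I -> set X) (s : I -> R)
    (A_condenser : generalized_condenser A s)
    (A_capacity : forall i, 0 < capacity k (A i))
    (a : I -> R) (a_pos : forall i, (0 < a i)%R)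
    (f : I -> X -> \bar R)
    (f_field : external_field k A f)
    (xi : I -> option {measure set (borel X) -> \bar R})
    (xi_constraint : constraint A a xi)
    (S_nonempty : minimizers k A s a f xi !=set0)
    (A_ess_disjoint : forall i j, i != j -> capacity k (A i `&` A j) = 0) :
  exists2 mu, minimizers k A s a f xi mu &
    forall nu, minimizers k A s a f xi nu -> forall i, eqm (nu i) (mu i).
Proof.
have [mu minmu] := S_nonempty; exists mu => // nu minnu.
have [k_ge0 kC _] := k_kernel.
have k_measurable := kernel_measurable X_metrizable X_countable k_kernel.
exact: (minimizers_unique X_hausdorff k_ge0 kC k_measurable k_spd A_condenser
  A_ess_disjoint minnu minmu).
Qed.
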